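(* Let $p$ be a prime. Let $k\ge 1$ be an integer such that $k\not\equiv 0 \pmod{4}$ and $\mathcal{D}:=(k^2+4)/\gcd(2,k)^2$ is squarefree. Then $p$ is a $k$-Wall-Sun-Sun prime if and only if the polynomial $\mathcal{F}_p(x):=x^{2p}-kx^p-1$ is non-monogenic. Furthermore, if $p$ is a prime divisor of $k^2+4$, then $\mathcal{F}_p(x)$ is monogenic.
   Context: For an integer $k\ge 1$, let $(U_n)$ be the sequence defined by $U_0=0$, $U_1=1$ and $U_n=kU_{n-1}+U_{n-2}$ for $n\ge 2$. This sequence is periodic modulo every integer $m\ge 2$; let $\pi(m)$ denote the length of the period modulo $m$. A prime $p$ is called a $k$-Wall-Sun-Sun prime if $\pi(p^2)=\pi(p)$. A monic polynomial $f(x)\in\mathbb{Z}[x]$ of degree $N$, irreducible over $\mathbb{Q}$, is called monogenic if $\{1,\theta,\ldots,\theta^{N-1}\}$ is a basis for the ring of integers $\mathbb{Z}_K$ of $K=\mathbb{Q}(\theta)$, where $f(\theta)=0$ (equivalently $[\mathbb{Z}_K:\mathbb{Z}[\theta]]=1$), and non-monogenic otherwise. *)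

(* Defs.v *)
From HB Require Import structures.
From mathcomp Require Import all_boot all_order all_algebra all_field.
Set Implicit Arguments. Unset Strict Implicit. Unset Printing Implicit Defensive.
Import Order.TTheory GRing.Theory Num.Theory.

Fixpoint Upair (k n : nat) : nat * nat :=
  match n with
  | 0 => (0, 1)
  | n'.+1 => let: (a, b) := Upair k n' in (b, k * b + a)
  end.
Definition U (k n : nat) : nat := (Upair k n).1.

Definition is_period (k m n : nat) : Prop :=
  0 < n /\ forall i, U k (i + n) = U k i %[mod m].

Definition is_pi (k m n : nat) : Prop :=
  is_period k m n /\ forall n', is_period k m n' -> n <= n'.

Definition wall_sun_sun (k p : nat) : Prop :=
  prime p /\ exists n, is_pi k p n /\ is_pi k (p ^ 2) n.

Definition squarefree (n : nat) : Prop :=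
  forall q, prime q -> ~~ (q ^ 2 %| n).

Local Open Scope ring_scope.

(* monic irreducible f in Z[x] is monogenic: for a root theta of f (in algC),
   the ring of integers of Q(theta) equals Z[theta]. *)
Definition monogenic (f : {poly int}) : Prop :=
  f \is monic /\
  irreducible_poly (map_poly (intr : int -> rat) f) /\
  forall theta : algC, root (map_poly (intr : int -> algC) f) theta ->
    forall x : algC,
      (exists q : {poly rat}, x = (map_poly (ratr : rat -> algC) q).[theta]) ->
      x \in Aint ->
      exists g : {poly int}, x = (map_poly (intr : int -> algC) g).[theta].

Definition Fpoly (k p : nat) : {poly int} :=
  'X^(2 * p) - (k%:Z)%:P * 'X^p - 1.

(* Main.v *)
Require Import Defs.
From mathcomp Require Import all_boot all_order all_algebra all_field.
From mathcomp Require Import ring zify.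
Set Implicit Arguments. Unset Strict Implicit. Unset Printing Implicit Defensive.
Import Order.TTheory GRing.Theory Num.Theory.
Local Open Scope ring_scope.

(* Write f = F_p, g = F_1 = x^2 - kx - 1, let alpha be a root of g and let
   V_p = k U_p + 2 U_(p-1) be the trace of alpha^p.  Dedekind's criterion at a
   prime q needs f = d^e + q F with d separable modulo q and F prime to d.
   - If q does not divide p(k^2 + 4), then f is separable modulo q.
   - If q | k^2 + 4, squarefreeness gives c with 2c = k modulo q^2 and q exactly
     dividing c^2 + 1; take d = x^p - c, e = 2 if q <> p, and d = x - c, e = 2p
     if q = p.
   - If q = p is odd and prime to k^2 + 4, then f = g^p + p (g T + w x^p) with
     p w = V_p - k, so the criterion holds when p does not divide w.  If p | w,
     then g(theta)^(p-1) / p is an integer outside Z[theta].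
   Moreover alpha^p has trace V_p and norm -1, so p | w means that modulo p^2 it
   is alpha or its conjugate, i.e. that p is a k-Wall-Sun-Sun prime.
   Irreducibility comes from the same data: complementary factors of f are
   coprime modulo p, which forces e to divide their degrees, while comparing
   absolute values of the roots shows that their degrees are even. *)

Local Notation u k n := (Posz (U k n)).
Local Notation red q h := (map_poly (intr : int -> 'F_q) h).
Local Notation ev t h := (map_poly (intr : int -> algC) h).[t].
Local Notation pQ h := (map_poly (intr : int -> rat) h).
Local Notation cst n := ((Posz n)%:P : {poly int}).

(** * Periods of U *)

Lemma UpairE k n : Upair k n = (U k n, U k n.+1).
Proof. by rewrite /U /=; case: (Upair k n). Qed.

Lemma U_rec k n : U k n.+2 = (k * U k n.+1 + U k n)%N.
Proof. by rewrite {1}/U /= UpairE. Qed.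

Lemma U0 k : U k 0 = 0%N. Proof. by []. Qed.
Lemma U1 k : U k 1 = 1%N. Proof. by []. Qed.

Lemma U_add k m n :
  U k (m + n).+1 = (U k m.+1 * U k n.+1 + U k m * U k n)%N.
Proof.
suff [] : U k (m + n).+1 = (U k m.+1 * U k n.+1 + U k m * U k n)%N /\
  U k (m.+1 + n).+1 = (U k m.+2 * U k n.+1 + U k m.+1 * U k n)%N by [].
elim: m => [|m [IH1 IH2]].
  by rewrite add0n add1n !U_rec U1 U0; split; lia.
split=> //; rewrite !addSn U_rec -addSn IH2 IH1.
by rewrite ![U k _.+3]U_rec ![U k m.+2]U_rec; ring.
Qed.

(** The factor [u k m.+1 - k%:Z * u k m] is U_(m-1), spelled so that m = 0 is covered. *)
Lemma U_addz k m n :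
  u k (m + n) = u k m * u k n.+1 + (u k m.+1 - k%:Z * u k m) * u k n.
Proof.
case: m => [|m]; first by rewrite add0n U0 U1; ring.
by rewrite addSn U_add U_rec !PoszD !PoszM; ring.
Qed.

(** Since alpha^n = U_(n+1) - U_n alpha' with alpha' the conjugate of alpha, the left side is the
    norm of alpha^n. *)
Lemma cassini k n :
  u k n.+1 ^+ 2 - k%:Z * u k n.+1 * u k n - u k n ^+ 2 = (-1) ^+ n.
Proof.
elim: n => [|n IH]; first by rewrite U0 U1; ring.
rewrite [RHS]exprS -IH U_rec PoszD PoszM; ring.
Qed.

Lemma modn_dvdz (m a b : nat) : (a = b %[mod m])%N <-> (m%:Z %| a%:Z - b%:Z)%Z.
Proof.
rewrite -eqz_mod_dvd !modz_nat; split=> [->//|/eqP[]//].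
Qed.

Lemma Posz_sqr (m : nat) : (m ^ 2)%:Z = m%:Z ^+ 2.
Proof. by rewrite expnSr expn1 PoszM. Qed.

(** A second-order recurrence is determined by two consecutive terms, so periodicity need only be
    tested at the indices 0 and 1. *)
Lemma is_periodP k m n : is_period k m n <->
  [/\ (0 < n)%N, (m%:Z %| u k n)%Z & (m%:Z %| u k n.+1 - 1)%Z].
Proof.
split=> [[n_gt0 per]|[n_gt0 Hn Hn1]].
  split=> //; first by move/modn_dvdz: (per 0%N); rewrite add0n subr0.
  by move/modn_dvdz: (per 1%N); rewrite add1n.
split=> // i; apply/modn_dvdz; rewrite U_addz.
have -> : u k i * u k n.+1 + (u k i.+1 - k%:Z * u k i) * u k n - u k i
  = u k i * (u k n.+1 - 1) + (u k i.+1 - k%:Z * u k i) * u k n.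
  by ring.
by rewrite rpredD ?dvdz_mull.
Qed.

Lemma is_period_dvd k m m' n :
  (m' %| m)%N -> is_period k m n -> is_period k m' n.
Proof.
move=> dvd /is_periodP[n_gt0 H0 H1]; apply/is_periodP; split=> //.
  exact: dvdz_trans H0.
exact: dvdz_trans H1.
Qed.

Lemma is_period_mul k m n j :
  (0 < j)%N -> is_period k m n -> is_period k m (j * n).
Proof.
move=> j_gt0 [n_gt0 per]; split; first by rewrite muln_gt0 j_gt0.
move=> i; elim: j {j_gt0} => [|j IH]; first by rewrite addn0.
by rewrite mulSn (addnC n) addnA per.
Qed.

Lemma least_period_dvd k m n N :
  is_pi k m n -> is_period k m N -> (n %| N)%N.
Proof.
move=> [[n_gt0 per] n_min] [N_gt0 perN].
rewrite /dvdn -leqn0 leqNgt; apply/negP=> r_gt0.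
have : is_period k m (N %% n).
  split=> // i; rewrite -[RHS]perN {2}(divn_eq N n) addnCA.
  elim: (N %/ n)%N => [|q IH]; first by rewrite add0n.
  by rewrite mulSn -addnA (addnC n) per.
by move/n_min; rewrite leqNgt ltn_mod n_gt0.
Qed.

Lemma exists_pi k m N : is_period k m N -> exists n, is_pi k m n.
Proof.
pose P n := [&& (0 < n)%N, (m%:Z %| u k n)%Z & (m%:Z %| u k n.+1 - 1)%Z].
have PP n : reflect (is_period k m n) (P n).
  apply: (iffP and3P) => [H|/is_periodP//].
  by apply/is_periodP.
move=> perN; have exP : exists n, P n by exists N; apply/PP.
exists (ex_minn exP); case: ex_minnP => n /PP pern n_min.
by split=> // n' /PP; apply: n_min.
Qed.

(** If p divides the entries of M - 1, with M the n-th power of the companion matrix, then M^j = 1 +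
    j (M - 1) modulo p^2. *)
Lemma period_mod_sq k p n j :
  (p%:Z %| u k n)%Z -> (p%:Z %| u k n.+1 - 1)%Z ->
  ((p ^ 2)%:Z %| u k (j * n) - j%:Z * u k n)%Z /\
  ((p ^ 2)%:Z %| u k (j * n).+1 - 1 - j%:Z * (u k n.+1 - 1))%Z.
Proof.
rewrite Posz_sqr => /dvdzP[a Ha] /dvdzP[c Hc].
have {}Hc : u k n.+1 = 1 + c * p by rewrite -Hc; ring.
elim: j => [|j [/dvdzP[s Hs] /dvdzP[t Ht]]].
  by rewrite mul0n U0 U1 !mul0r subrr dvdz0.
have {}Hs : u k (j * n) = j%:Z * (a * p) + s * p%:Z ^+ 2.
  by rewrite -Ha -Hs; ring.
have {}Ht : u k (j * n).+1 = 1 + j%:Z * (c * p) + t * p%:Z ^+ 2.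
  by rewrite -Ht Hc; ring.
have Ej : j.+1%:Z = j%:Z + 1 by rewrite -addn1 PoszD.
have E0 := U_addz k (j * n) n.
have E1 : u k (j * n + n).+1 = u k (j * n).+1 * u k n.+1 + u k (j * n) * u k n.
  by rewrite U_add PoszD !PoszM.
rewrite mulSn addnC {}E0 {}E1 Ha Hc Hs Ht Ej.
split; apply/dvdzP.
  exists (j%:Z * a * c + s * (1 + c * p) + j%:Z * c * a + t * a * p
    - k%:Z * (j%:Z * a + s * p) * a).
  by ring.
by exists (j%:Z * c * c + t * (1 + c * p) + (j%:Z * a + s * p) * a); ring.
Qed.

(** N is j times the period n modulo p, with j prime to p. By [period_mod_sq] the defect at N is j
    times the defect at n modulo p^2, so n is already a period modulo p^2. *)
Lemma wall_sun_sun_of_period k p N :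
  prime p -> is_period k (p ^ 2) N -> ~~ (p %| N)%N -> wall_sun_sun k p.
Proof.
move=> p_pr perN pN; split=> //.
have dvd2 : (p %| p ^ 2)%N by rewrite dvdn_exp.
have perN1 : is_period k p N by apply: is_period_dvd perN.
have [n pi_n] := exists_pi perN1; exists n; split=> //.
have [j defN] := dvdnP (least_period_dvd pi_n perN1).
have [pern n_min] := pi_n; split; last first.
  by move=> n' /(is_period_dvd dvd2); apply: n_min.
have /is_periodP[n_gt0 H0 H1] := pern.
have [] := period_mod_sq j H0 H1; rewrite -defN => E0 E1.
have /is_periodP[_ N0 N1] := perN.
have pj : coprimez (p ^ 2)%:Z j%:Z.
  rewrite coprimezE /= coprimeXl // prime_coprime //.
  by apply: contra pN; rewrite defN; apply: dvdn_mulr.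
apply/is_periodP; split=> //.
  by rewrite -(Gauss_dvdzr _ pj) -(rpredBl _ N0).
by rewrite -(Gauss_dvdzr _ pj) -(rpredBl _ N1).
Qed.

Lemma wall_sun_sun_period k p N :
  wall_sun_sun k p -> is_period k p N -> is_period k (p ^ 2) N.
Proof.
move=> [_ [n [pi1 [per2 _]]]] perN.
have /dvdnP[j defN] := least_period_dvd pi1 perN.
rewrite defN; apply: is_period_mul per2.
by case: perN; rewrite defN muln_gt0 => /andP[].
Qed.

Lemma U_double k m :
  u k (m + m) = u k m * (2 * u k m.+1 - k%:Z * u k m) /\
  u k (m + m).+1 = u k m.+1 ^+ 2 + u k m ^+ 2.
Proof.
split; first by rewrite U_addz; ring.
by rewrite U_add PoszD !PoszM; ring.
Qed.

(** The hypotheses say alpha^m = -1 modulo d; then alpha^(2m) = 1. *)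
Lemma is_period_double k d m :
  (0 < m)%N -> (d%:Z %| u k m)%Z -> (d%:Z %| u k m.+1 + 1)%Z ->
  is_period k d (m + m).
Proof.
move=> m_gt0 H0 H1; have [D0 D1] := U_double k m.
apply/is_periodP; split; first by rewrite addn_gt0 m_gt0.
  by rewrite D0 dvdz_mulr.
have -> : u k (m + m).+1 - 1
  = (u k m.+1 + 1) * (u k m.+1 - 1) + u k m * u k m by rewrite D1; ring.
by rewrite rpredD // dvdz_mulr.
Qed.

Lemma Euclid_dvdzM p (a b : int) : prime p ->
  (p%:Z %| a * b)%Z = (p%:Z %| a)%Z || (p%:Z %| b)%Z.
Proof. by move=> p_pr; rewrite !dvdzE abszM Euclid_dvdM. Qed.

Lemma Euclid_dvdzX p (a : int) n : prime p ->
  (p%:Z %| a ^+ n)%Z -> (p%:Z %| a)%Z.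
Proof. by move=> p_pr; rewrite !dvdzE abszX Euclid_dvdX // => /andP[]. Qed.

Lemma sqr_dvdz_cancel p (a b : int) : prime p -> ~~ (p%:Z %| a)%Z ->
  ((p ^ 2)%:Z %| a * b)%Z = ((p ^ 2)%:Z %| b)%Z.
Proof.
move=> p_pr pa; apply: Gauss_dvdzr.
by rewrite coprimezE /= coprimeXl // prime_coprime.
Qed.

Lemma odd_prime_dvdz2 p : prime p -> odd p -> ~~ (p%:Z %| 2)%Z.
Proof.
move=> p_pr p_odd; rewrite dvdzE /= dvdn_prime2 //.
by apply: contraL p_odd => /eqP->.
Qed.

Lemma dvdz_sqr p (a : int) : ((p ^ 2)%:Z %| a)%Z -> (p%:Z %| a)%Z.
Proof. by apply: dvdz_trans; rewrite dvdzE /= dvdn_exp. Qed.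

Lemma sqr_dvdz_pm1 p (a : int) : prime p -> odd p ->
  ((p ^ 2)%:Z %| (a - 1) * (a + 1))%Z ->
  ((p ^ 2)%:Z %| a - 1)%Z \/ ((p ^ 2)%:Z %| a + 1)%Z.
Proof.
move=> p_pr p_odd dvd; have [p1|p1] := boolP (p%:Z %| a - 1)%Z; last first.
  by right; rewrite -(sqr_dvdz_cancel _ p_pr p1).
left; rewrite mulrC in dvd; rewrite -(sqr_dvdz_cancel (a := a + 1) _ p_pr) //.
apply: contra (odd_prime_dvdz2 p_pr p_odd) => p2.
have -> : 2%Z = (a + 1) - (a - 1) by ring.
by rewrite rpredB.
Qed.

(* [U n] and [U n.+1] with [n.+1 = p] determine alpha^p = U_p alpha + U_(p-1);
   [k * U n.+1 + 2 * U n] is its trace V_p, and its norm is -1, so V_p = k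
   modulo p^2 forces alpha^p to be alpha or its conjugate modulo p^2. *)
Lemma wall_sun_sun_trace k n (t := k%:Z * u k n.+1 + 2 * u k n - k%:Z) :
  prime n.+1 -> odd n.+1 -> ~~ (n.+1 %| k ^ 2 + 4)%N ->
  (n.+1%:Z %| t)%Z ->
  wall_sun_sun k n.+1 <-> ((n.+1 ^ 2)%:Z %| t)%Z.
Proof.
set p := n.+1 => p_pr p_odd pD pt.
have p2 := odd_prime_dvdz2 p_pr p_odd.
have n_gt0 : (0 < n)%N by rewrite -ltnS; apply: prime_gt1.
(* With D = k^2 + 4, trace and norm of alpha^p give V_p^2 - D U_p^2 = -4; subtract k^2 - D = -4 and
   factor V_p^2 - k^2. *)
have disc : (k ^ 2 + 4)%:Z * ((u k p - 1) * (u k p + 1)) = t * (t + 2 * k%:Z).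
  have := cassini k n; rewrite -signr_odd -/p (negbTE (_ : ~~ odd n)) // => cas.
  rewrite PoszD Posz_sqr.
  have -> : (k%:Z ^+ 2 + 4%:Z) * ((u k p - 1) * (u k p + 1))
    = k%:Z ^+ 2 * (u k p ^+ 2 - 1) + 4 * (u k p ^+ 2) - 4 * ((-1) ^+ false).
    by rewrite /=; ring.
  by rewrite -cas /t; ring.
have pDz : ~~ (p%:Z %| (k ^ 2 + 4)%:Z)%Z by rewrite dvdzE.
have Up1 : u k n.+2 = k%:Z * u k p + u k n by rewrite U_rec PoszD PoszM.
have Up2 : u k n.+3 = k%:Z * u k n.+2 + u k p by rewrite U_rec PoszD PoszM.
have dvd_t (d : nat) :
    (d%:Z %| u k n.+2)%Z -> (d%:Z %| u k n.+3 + 1)%Z -> (d%:Z %| t)%Z.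
  move=> d1 d2.
  have -> : t = 2 * u k n.+2 - k%:Z * (u k n.+3 + 1) + k%:Z ^+ 2 * u k n.+2.
    by rewrite Up2 Up1 /t; ring.
  by rewrite rpredD ?rpredB // dvdz_mull.
split=> [wss | p2t]; last first.
  have : ((p ^ 2)%:Z %| (u k p - 1) * (u k p + 1))%Z.
    by rewrite -(sqr_dvdz_cancel _ p_pr pDz) disc dvdz_mulr.
  (* If U_p = 1, then alpha^p = alpha and p - 1 is a period. If U_p = -1, then alpha^p = -1/alpha,
     so alpha^(p+1) = -1 and 2(p+1) is a period. Neither is divisible by p. *)
  case/(sqr_dvdz_pm1 p_pr p_odd) => H.
    apply: (@wall_sun_sun_of_period _ _ n) => //; last first.
      by apply/negP => /dvdn_leq; rewrite n_gt0 ltnn; case/(_ isT)/negP.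
    apply/is_periodP; split=> //.
    rewrite -(sqr_dvdz_cancel (a := 2) _ p_pr) //.
    have -> : 2 * u k n = t - k%:Z * (u k p - 1) by rewrite /t; ring.
    by rewrite rpredB // dvdz_mull.
  have H0 : ((p ^ 2)%:Z %| u k n.+2)%Z.
    rewrite -(sqr_dvdz_cancel (a := 2) _ p_pr) //.
    have -> : 2 * u k n.+2 = t + k%:Z * (u k p + 1) by rewrite Up1 /t; ring.
    by rewrite rpredD // dvdz_mull.
  have H1 : ((p ^ 2)%:Z %| u k n.+3 + 1)%Z.
    have -> : u k n.+3 + 1 = k%:Z * u k n.+2 + (u k p + 1) by rewrite Up2; ring.
    by rewrite rpredD // dvdz_mull.
  apply: (@wall_sun_sun_of_period _ _ (n.+2 + n.+2)) => //.
    exact: is_period_double.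
  rewrite -[(n.+2 + n.+2)%N]/((p.+1 + p.+1)%N) addnn -muln2 Euclid_dvdM //.
  rewrite -{1}addn1 dvdn_addr // dvdn1 negb_or.
  by move: p2; rewrite dvdzE => ->; rewrite andbT; apply/eqP => E; rewrite E in p_pr.
(* The same two alternatives hold modulo p because p divides t; the Wall-Sun-Sun hypothesis lifts
   the resulting period to p^2. *)
have : (p%:Z %| (u k p - 1) * (u k p + 1))%Z.
  have : (p%:Z %| (k ^ 2 + 4)%:Z * ((u k p - 1) * (u k p + 1)))%Z.
    by rewrite disc dvdz_mulr.
  by rewrite Euclid_dvdzM // (negbTE pDz).
rewrite Euclid_dvdzM // => /orP[] H.
  have /(wall_sun_sun_period wss)/is_periodP[_ E0 E1] : is_period k p n.
    apply/is_periodP; split=> //.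
    have : (p%:Z %| 2 * u k n)%Z.
      have -> : 2 * u k n = t - k%:Z * (u k p - 1) by rewrite /t; ring.
      by rewrite rpredB // dvdz_mull.
    by rewrite Euclid_dvdzM // (negbTE p2).
  have -> : t = k%:Z * (u k p - 1) + 2 * u k n by rewrite /t; ring.
  by rewrite rpredD // dvdz_mull.
have H0 : (p%:Z %| u k n.+2)%Z.
  have : (p%:Z %| 2 * u k n.+2)%Z.
    have -> : 2 * u k n.+2 = t + k%:Z * (u k p + 1) by rewrite Up1 /t; ring.
    by rewrite rpredD // dvdz_mull.
  by rewrite Euclid_dvdzM // (negbTE p2).
have H1 : (p%:Z %| u k n.+3 + 1)%Z.
  have -> : u k n.+3 + 1 = k%:Z * u k n.+2 + (u k p + 1) by rewrite Up2; ring.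
  by rewrite rpredD // dvdz_mull.
have /(wall_sun_sun_period wss)/is_periodP[_] : is_period k p (n.+2 + n.+2).
  exact: is_period_double.
(* With m = p + 1, U_(2m) = U_m V_m and V_m = -2 modulo p is invertible, so p^2 divides U_m. Then
   U_(m+1)^2 = 1 modulo p^2, and U_(m+1) = -1 modulo p fixes the sign. *)
have [-> ->] := U_double k n.+2; rewrite mulrC sqr_dvdz_cancel //; last first.
  apply: contra p2 => Hc.
  have -> : 2%Z = 2 * (u k n.+3 + 1) - k%:Z * u k n.+2
      - (2 * u k n.+3 - k%:Z * u k n.+2) by ring.
  by rewrite rpredB // rpredB // dvdz_mull.
move=> E0 E1; apply: dvd_t => //.
have : ((p ^ 2)%:Z %| (u k n.+3 - 1) * (u k n.+3 + 1))%Z.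
  have -> : (u k n.+3 - 1) * (u k n.+3 + 1)
    = u k n.+3 ^+ 2 + u k n.+2 ^+ 2 - 1 - u k n.+2 * u k n.+2 by ring.
  by rewrite rpredB // dvdz_mulr.
case/(sqr_dvdz_pm1 p_pr p_odd) => // /dvdz_sqr H2.
case/negP: p2; have -> : 2%Z = (u k n.+3 + 1) - (u k n.+3 - 1) by ring.
by rewrite rpredB.
Qed.

(* Expansion of (2 alpha)^n = (k + sqrt D)^n modulo D^2; the factor k^3 avoids
   negative exponents of k. *)
Lemma U_mod_disc k n (D := k%:Z ^+ 2 + 4) :
  (exists s, k%:Z ^+ 3 * 2 ^+ n * u k n
     = 2 * (n%:Z * k%:Z ^+ n.+2 + 'C(n, 3)%:Z * k%:Z ^+ n * D) + D ^+ 2 * s) /\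
  (exists s, k%:Z ^+ 3 * 2 ^+ n * (2 * u k n.+1 - k%:Z * u k n)
     = 2 * (k%:Z ^+ n.+3 + 'C(n, 2)%:Z * k%:Z ^+ n.+1 * D) + D ^+ 2 * s).
Proof.
elim: n => [|n [[s Hs] [t Ht]]].
  by split; exists 0; rewrite /D ?U0 ?U1 ?bin0n /= ?bin_small //; ring.
split.
  exists (t + k%:Z * s).
  have -> : k%:Z ^+ 3 * 2 ^+ n.+1 * u k n.+1
    = k%:Z ^+ 3 * 2 ^+ n * (2 * u k n.+1 - k%:Z * u k n)
      + k%:Z * (k%:Z ^+ 3 * 2 ^+ n * u k n) by rewrite [2 ^+ _.+1]exprS; ring.
  have -> : n.+1%:Z = n%:Z + 1 by rewrite -addn1 PoszD.
  by rewrite Hs Ht binS PoszD !exprS /D; ring.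
exists (k%:Z * t + D * s + 2 * 'C(n, 3)%:Z * k%:Z ^+ n).
have -> : k%:Z ^+ 3 * 2 ^+ n.+1 * (2 * u k n.+2 - k%:Z * u k n.+1)
  = k%:Z * (k%:Z ^+ 3 * 2 ^+ n * (2 * u k n.+1 - k%:Z * u k n))
    + D * (k%:Z ^+ 3 * 2 ^+ n * u k n).
  by rewrite [2 ^+ _.+1]exprS U_rec PoszD PoszM /D; ring.
by rewrite Hs Ht binS bin1 PoszD !exprS /D; ring.
Qed.

(** k^2 + 4 is 1 or 2 modulo 3. Excluding p = 3 makes the binomial coefficient C(p, 3) of
    [U_mod_disc] divisible by p. *)
Lemma prime_dvd_disc_neq3 k p : prime p -> (p %| k ^ 2 + 4)%N -> p != 3%N.
Proof.
move=> p_pr; apply: contraL => /eqP->.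
rewrite /dvdn -modnDm -modnXm; have : (k %% 3 < 3)%N by rewrite ltn_mod.
by case: (k %% 3)%N => [|[|[|]]].
Qed.

(** Here p divides U_p exactly once and alpha^(2p) = -1 modulo p, so 4p is a period modulo p. But
    U_(4p) = U_p V_p V_(2p) with V_p and V_(2p) prime to p, so p^2 does not divide it. *)
Lemma not_wall_sun_sun_ramified k p :
  prime p -> odd p -> (p %| k ^ 2 + 4)%N -> ~ wall_sun_sun k p.
Proof.
move=> p_pr p_odd pD wss.
have p2 := odd_prime_dvdz2 p_pr p_odd.
have p_gt3 : (3 < p)%N.
  have := prime_dvd_disc_neq3 p_pr pD; have := prime_gt1 p_pr.
  by case: p p_odd {p_pr pD wss p2} => [|[|[|[|]]]].
have pDz : (p%:Z %| k%:Z ^+ 2 + 4)%Z by rewrite -Posz_sqr -PoszD.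
have pk : ~~ (p%:Z %| k%:Z)%Z.
  apply: contra p2 => pk; apply: (@Euclid_dvdzX _ _ 2) => //.
  have -> : 2 ^+ 2 = (k%:Z ^+ 2 + 4) - k%:Z * k%:Z by ring.
  by rewrite rpredB // dvdz_mulr.
have [[s Hs] _] := U_mod_disc k p.
have pbin : (p%:Z %| 'C(p, 3)%:Z)%Z by rewrite dvdzE /= prime_dvd_bin.
(* In [U_mod_disc], D and C(p, 3) are both multiples of p, so only the term linear in p survives
   modulo p^2. *)
have key : ((p ^ 2)%:Z %| 2 ^+ p * k%:Z ^+ 3 * u k p - 2 * k%:Z ^+ p.+2 * p%:Z)%Z.
  have /dvdzP[a Ha] := pDz; have /dvdzP[b Hb] := pbin.
  have -> : 2 ^+ p * k%:Z ^+ 3 * u k p = k%:Z ^+ 3 * 2 ^+ p * u k p by ring.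
  rewrite Hs Ha Hb Posz_sqr; apply/dvdzP.
  by exists (2 * b * k%:Z ^+ p * a + a ^+ 2 * s); ring.
have p2k n m : ~~ (p%:Z %| 2 ^+ n * k%:Z ^+ m)%Z.
  rewrite Euclid_dvdzM // negb_or; apply/andP; split.
    by apply: contra p2; apply: Euclid_dvdzX.
  by apply: contra pk; apply: Euclid_dvdzX.
have pU : (p%:Z %| u k p)%Z.
  have := dvdz_sqr key; rewrite (rpredBr _ (dvdz_mull _ (dvdzz _))).
  by rewrite Euclid_dvdzM // (negbTE (p2k _ _)).
have p2U : ~~ ((p ^ 2)%:Z %| u k p)%Z.
  apply/negP => H; move: key; rewrite (rpredBl _ (dvdz_mull _ H)).
  rewrite -[2]expr1 sqr_dvdz_cancel // dvdzE /= => /dvdn_leq.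
  by rewrite prime_gt0 // => /(_ isT); rewrite leqNgt ltn_Pmulr ?prime_gt1 ?prime_gt0.
have [D0 D1] := U_double k p.
have cas := cassini k p; rewrite -signr_odd p_odd /= expr1 in cas.
have w1 : (p%:Z %| u k p.+1 ^+ 2 + 1)%Z.
  have -> : u k p.+1 ^+ 2 + 1 = u k p * (k%:Z * u k p.+1 + u k p).
    by rewrite -[1]opprK -cas; ring.
  by rewrite dvdz_mulr.
have H0 : (p%:Z %| u k (p + p))%Z by rewrite D0 dvdz_mulr.
have H1 : (p%:Z %| u k (p + p).+1 + 1)%Z.
  have -> : u k (p + p).+1 + 1 = (u k p.+1 ^+ 2 + 1) + u k p * u k p.
    by rewrite D1; ring.
  by rewrite rpredD // dvdz_mulr.
have := is_period_double _ H0 H1; rewrite addn_gt0 prime_gt0 // => /(_ isT).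
case/(wall_sun_sun_period wss)/is_periodP => _ + _.
have [-> _] := U_double k (p + p).
rewrite mulrC sqr_dvdz_cancel //; last first.
  apply: contra p2 => Hc.
  have -> : 2%Z = 2 * (u k (p + p).+1 + 1) - k%:Z * u k (p + p)
      - (2 * u k (p + p).+1 - k%:Z * u k (p + p)) by ring.
  by rewrite rpredB // rpredB // dvdz_mull.
rewrite D0 mulrC sqr_dvdz_cancel ?(negbTE p2U) //.
apply: contra (p2k 1%N 0%N) => H; rewrite expr0 mulr1 expr1.
have : (p%:Z %| 2 * u k p.+1)%Z.
  have -> : 2 * u k p.+1 = 2 * u k p.+1 - k%:Z * u k p + k%:Z * u k p by ring.
  by rewrite rpredD // dvdz_mull.
rewrite Euclid_dvdzM // (negbTE p2) /= => pw.
have : (p%:Z %| 1)%Z.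
  have -> : 1%Z = (u k p.+1 ^+ 2 + 1) - u k p.+1 * u k p.+1 by ring.
  by rewrite rpredB // dvdz_mulr.
by rewrite dvdzE /= dvdn1 => /eqP p1; rewrite p1 in p_pr.
Qed.

(** The period modulo 2 is at most 3, and 4 divides none of U_1 = 1, U_2 = k, U_3 = k^2 + 1. *)
Lemma not_wall_sun_sun_2 k : ~~ (4 %| k)%N -> ~ wall_sun_sun k 2.
Proof.
move=> k4 wss.
have [n [[per1 n_min] [/is_periodP[n_gt0 H0 _] _]]] := proj2 wss.
have n_le3 : (n <= 3)%N.
  have [k_odd|k_even] := boolP (odd k).
    apply: n_min; apply/is_periodP; rewrite !U_rec U0 U1 muln1 addn0.
    split=> //; first by rewrite dvdzE /= dvdn2 oddD oddM k_odd.
    have -> : (k * (k * k + 1) + k)%:Z - 1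
      = (k * (k * k + 1) + k.-1)%N :> int by case: (k) k_odd => // m _; lia.
    by rewrite dvdzE /= dvdn2 oddD !oddM oddD !oddM k_odd; case: (k) k_odd.
  apply: leq_trans (n_min 2%N _) _ => //.
  apply/is_periodP; rewrite !U_rec U0 U1 muln1 addn0; split=> //.
    by rewrite dvdzE /= dvdn2.
  by rewrite PoszD addrK dvdzE /= dvdn2 oddM (negbTE k_even).
move: H0; rewrite dvdzE /=; case: n n_gt0 n_le3 {per1 n_min} => [|[|[|[|]]]] // _ _.
- by rewrite U_rec U0 U1 muln1 addn0; apply/negP.
rewrite !U_rec U0 U1 muln1 addn0 /dvdn -modnDml -modnMm modnDml.
have : (k %% 4 < 4)%N by rewrite ltn_mod.
by case: (k %% 4)%N => [|[|[|[|]]]].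
Qed.

(** * Dedekind's criterion *)

(** A separable d has no repeated factor, so dividing out gcd(d, h) removes everything d shares with
    h. *)
Lemma separable_cofactor_coprime (F : fieldType) (d h : {poly F}) :
  separable_poly d ->
  exists t, d = t * gcdp d h /\ coprimep t h.
Proof.
move=> sepd; have /dvdpP[t def_d] := dvdp_gcdl d h; exists t; split=> //.
have cop_te : coprimep t (gcdp d h).
  by apply: (separable_coprime sepd); rewrite -def_d.
apply/coprimepP => r rt rh; apply: (coprimepP _ _ cop_te) => //.
by rewrite dvdp_gcd rh andbT def_d dvdp_mulr.
Qed.

Lemma separable_dvdp_exp (F : fieldType) (d h : {poly F}) m :
  separable_poly d -> d %| h ^+ m -> d %| h.
Proof.
move=> sepd dvd; have [t [def_d cop_th]] := separable_cofactor_coprime h sepd.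
have t1 : t %| 1.
  rewrite -(Gauss_dvdpl 1 (coprimep_expr m cop_th)) mul1r.
  by apply: dvdp_trans dvd; rewrite def_d dvdp_mulr.
apply: dvdp_trans (dvdp_gcdr d h).
by rewrite {1}def_d -{2}[gcdp d h]mul1r dvdp_mul.
Qed.

(** Each irreducible factor of d goes wholly to a or to b, so a is gcd(d, a)^e up to a unit. *)
Lemma coprime_factor_exp (F : fieldType) (d a b : {poly F}) e :
  separable_poly d -> a * b = d ^+ e -> coprimep a b ->
  (e %| (size a).-1)%N.
Proof.
move=> sepd ab cop; have [t [def_d cop_ta]] := separable_cofactor_coprime a sepd.
set g := gcdp d a in def_d.
suff /eqp_size-> : a %= g ^+ e by rewrite size_exp dvdn_mull.
rewrite /eqp; apply/andP; split.
  rewrite -(Gauss_dvdpr _ (_ : coprimep a (t ^+ e))).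
    by rewrite -exprMn -def_d -ab dvdp_mulr.
  by rewrite coprimep_sym coprimep_expl.
rewrite -(Gauss_dvdpl a (_ : coprimep (g ^+ e) b)).
  by rewrite ab dvdp_exp2r // dvdp_gcdl.
rewrite coprimep_expl //; apply: coprimep_dvdr cop; exact: dvdp_gcdr.
Qed.


Lemma intrFp_eq0 q (z : int) : prime q -> ((z%:~R : 'F_q) == 0) = (q%:Z %| z)%Z.
Proof. by move=> q_pr; rewrite (dvdz_pcharf (pchar_Fp q_pr)). Qed.

Lemma red_cst q : prime q -> red q (cst q) = 0.
Proof.
move=> q_pr; rewrite map_polyC; apply/eqP; rewrite polyC_eq0.
by apply/eqP; apply: (pcharf0 (pchar_Fp q_pr)).
Qed.

Lemma red_eq0 q (h : {poly int}) : prime q -> red q h = 0 ->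
  exists r, h = cst q * r.
Proof.
move=> q_pr h0; suff /polyOver_dvdzP[r ->] : h \is a polyOver (dvdz q).
  by exists r; rewrite mul_polyC.
apply/polyOverP => i; rewrite -intrFp_eq0 //.
by have := congr1 (fun p : {poly 'F_q} => p`_i) h0; rewrite coef_map coef0 /= => ->.
Qed.

Lemma red_surj q (d : {poly 'F_q}) : prime q -> exists h, red q h = d.
Proof.
move=> q_pr; exists (\poly_(i < size d) (nat_of_ord d`_i)%:Z).
apply/polyP => i; rewrite coef_map coef_poly /=.
case: ltnP => [_|le]; last by rewrite nth_default.
exact: natr_Zp.
Qed.

Lemma red_dvdp q (d h : {poly int}) : prime q -> red q d %| red q h ->
  exists s r, h = d * s + cst q * r.
Proof.
move=> q_pr /dvdpP[s0 E]; have [s Es] := red_surj s0 q_pr; exists s.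
have [|r Er] := @red_eq0 q (h - d * s) q_pr.
  by rewrite rmorphB rmorphM /= E Es mulrC subrr.
by exists r; rewrite -Er addrC subrK.
Qed.

Lemma size_red q (h : {poly int}) : prime q -> h \is monic ->
  size (red q h) = size h.
Proof.
move=> q_pr /monicP h1.
by rewrite size_map_poly_id0 // h1 rmorph1 oner_neq0.
Qed.

Lemma cst_neq0 q : prime q -> cst q != 0.
Proof. by move=> q_pr; rewrite polyC_eq0 -lt0n prime_gt0. Qed.

Lemma evC t (z : int) : ev t z%:P = z%:~R.
Proof. by rewrite map_polyC hornerC. Qed.

Lemma evM t (a b : {poly int}) : ev t (a * b) = ev t a * ev t b.
Proof. by rewrite rmorphM hornerM. Qed.

Lemma evD t (a b : {poly int}) : ev t (a + b) = ev t a + ev t b.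
Proof. by rewrite rmorphD hornerD. Qed.

Lemma evB t (a b : {poly int}) : ev t (a - b) = ev t a - ev t b.
Proof. by rewrite rmorphB !hornerE. Qed.

Lemma evX t (a : {poly int}) n : ev t (a ^+ n) = ev t a ^+ n.
Proof. by rewrite rmorphXn horner_exp. Qed.

Lemma Aint_ev f t h : f \is monic -> ev t f = 0 -> ev t h \in Aint.
Proof.
move=> f1 ft; have t_int : t \in Aint.
  apply: (@root_monic_Aint (map_poly intr f)); first by apply/rootP.
    exact: monic_map.
  by apply/polyOverP => i; rewrite coef_map intr_int.
rewrite horner_coef rpred_sum // => i _; rewrite rpredM ?rpredX //.
by rewrite coef_map Aint_int.
Qed.

Lemma Aint_int_root x : x \in Aint ->
  exists2 P : {poly int}, P \is monic & ev x P = 0.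
Proof.
move=> /floorpP[P defP]; exists P; last by rewrite -defP; apply/rootP/root_minCpoly.
have := minCpoly_monic x; rewrite defP => /monicP lead1.
apply/monicP; apply: (@intr_inj algC).
move: lead1; rewrite lead_coefE coef_map size_map_inj_poly //; exact: intr_inj.
Qed.

(** Multiply a monic equation of degree m for h(t)/q by q^m: every term but h(t)^m acquires a factor
    q. *)
Lemma Aint_div_pow t (h : {poly int}) q : (0 < q)%N -> ev t h / q%:R \in Aint ->
  exists m r, ev t (h ^+ m) = q%:R * ev t r.
Proof.
move=> q_gt0 /Aint_int_root[P P1 P0]; set y := _ / _ in P0.
have q0 : q%:R != 0 :> algC by rewrite pnatr_eq0 -lt0n.
have hE : ev t h = q%:R * y by rewrite mulrC divfK.
clearbody y.
have sP : size P = (size P).-1.+1 by rewrite prednK ?size_poly_gt0 ?monic_neq0.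
have sP' : size (map_poly intr P : {poly algC}) = (size P).-1.+1.
  rewrite -sP size_map_inj_poly //; exact: intr_inj.
exists (size P).-1.
exists (- \sum_(i < (size P).-1) (P`_i * q%:Z ^+ ((size P).-1 - i).-1)%:P * h ^+ i).
set m := (size P).-1 in sP sP' *.
have : q%:R ^+ m * ev y P = 0 by rewrite P0 mulr0.
rewrite horner_coef sP' big_ord_recr /= coef_map /= -/m.
have -> : P`_m = 1 by move/monicP: P1; rewrite lead_coefE.
rewrite mul1r mulrDr -exprMn -hE => /eqP; rewrite addrC addr_eq0 => /eqP E.
rewrite evX E rmorphN rmorph_sum /= hornerN horner_sum mulrN !mulr_sumr.
congr (- _); apply: eq_bigr => i _; rewrite -/(ev t _) evM evX evC coef_map /= hE.
rewrite rmorphM rmorphXn /= exprMn.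
have -> : q%:R ^+ m = q%:R * q%:R ^+ (m - i).-1 * q%:R ^+ i :> algC.
  by rewrite -exprS prednK ?subn_gt0 // -exprD subnK // ltnW.
have -> : q%:~R = q%:R :> algC by [].
by ring.
Qed.

(** Divide by the monic f inside Z[x]; a nonzero remainder has smaller degree, hence is coprime to f
    over Q and cannot vanish at t. *)
Lemma irr_ev_eq0 f t r : f \is monic -> irreducible_poly (pQ f) ->
  ev t f = 0 -> ev t r = 0 -> exists s, r = f * s.
Proof.
move=> f1 f_irr ft rt; have E := Pdiv.RingMonic.rdivp_eq f1 r.
set s := Pdiv.CommonRing.rmodp r f in E.
have st : ev t s = 0.
  by move: rt; rewrite E evD evM ft mulr0 add0r.
suff s0 : s = 0 by exists (Pdiv.CommonRing.rdivp r f); rewrite {1}E s0 addr0 mulrC.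
apply/eqP/negPn/negP => s_neq0.
have ratC (h : {poly int}) : map_poly (ratr : rat -> algC) (pQ h) = map_poly intr h.
  by rewrite -map_poly_comp; apply: eq_map_poly => x; apply: ratr_int.
have : coprimep (map_poly (ratr : rat -> algC) (pQ f)) (map_poly ratr (pQ s)).
  rewrite coprimep_map irreducible_poly_coprime //.
  apply/negP => /dvdp_leq; rewrite map_poly_eq0_id0 ?intr_eq0 ?lead_coef_eq0 //.
  move=> /(_ s_neq0).
  rewrite !size_map_inj_poly //; try exact: intr_inj.
  by rewrite leqNgt Pdiv.CommonRing.ltn_rmodpN0 ?monic_neq0.
rewrite !ratC => /coprimep_root/(_ (introT rootP ft)).
by rewrite st eqxx.
Qed.

(* Hypotheses of Dedekind's criterion at [q]; for [e = 1], [f] is already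
   separable modulo [q] and [F] is irrelevant. *)
Definition dedekind_at q (f d : {poly int}) e (F : {poly int}) : Prop :=
  [/\ separable_poly (red q d), (0 < e)%N, f = d ^+ e + cst q * F
    & (e == 1%N) || coprimep (red q d) (red q F)].

(* If [d^j s / q] is integral with [j < e], its [e]-th power times
   [q^(e-j-1)] is [+- F^j s^e / q] at the root, since [d^e = - q F] there. *)
Lemma dedekind_maximal q f d e F t h : prime q -> f \is monic ->
  irreducible_poly (pQ f) -> ev t f = 0 -> dedekind_at q f d e F ->
  ev t h / q%:R \in Aint -> exists g, ev t h / q%:R = ev t g.
Proof.
move=> q_pr f1 f_irr ft [sepd e_gt0 def_f copF] h_int.
have q0 : q%:R != 0 :> algC by rewrite pnatr_eq0 -lt0n prime_gt0.
have evq : ev t (cst q) = q%:R by rewrite evC.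
(* Some a^m is a multiple of q at t, so f, and with it d, divides a^m modulo q; separability of d
   removes the exponent. *)
have rad a : ev t a / q%:R \in Aint -> red q d %| red q a.
  move=> /(Aint_div_pow (prime_gt0 q_pr))[m [r E]].
  have [|s Es] := @irr_ev_eq0 f t (a ^+ m - cst q * r) f1 f_irr ft.
    by rewrite evB evM evq E subrr.
  apply: (separable_dvdp_exp (m := m) sepd).
  have -> : red q a ^+ m = red q f * red q s.
    by rewrite -rmorphM -Es rmorphB rmorphM /= red_cst // mul0r subr0 rmorphXn.
  rewrite def_f rmorphD rmorphM /= red_cst // mul0r addr0 rmorphXn /=.
  by apply: dvdp_mulr; rewrite dvdp_exp // -lt0n.
(* Climb through the ideals (d^j, q) of Z[x]. At j = e, the relation d^e = f - q F turns membership
   into divisibility by q at the root. *)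
have step j : (j <= e)%N -> exists s r, h = d ^+ j * s + cst q * r.
  elim: j => [_|j IH lt_je]; first by exists h, 0; rewrite mulr0 addr0 mul1r.
  have [s [r def_h]] := IH (ltnW lt_je).
  have [/eqP e1|e_neq1] := boolP (e == 1%N).
    have j0 : j = 0%N by move: lt_je; rewrite e1 ltnS leqn0 => /eqP.
    by rewrite j0 expr1; apply: red_dvdp (rad _ h_int).
  rewrite (negbTE e_neq1) /= in copF.
  have ds_int : ev t (d ^+ j * s) / q%:R \in Aint.
    have -> : ev t (d ^+ j * s) / q%:R = ev t h / q%:R - ev t r.
      by rewrite def_h evD evM [ev t (cst q * r)]evM evq; field.
    by rewrite rpredB // (Aint_ev _ f1 ft).
  have dte : ev t d ^+ e = - (q%:R * ev t F).
    apply/eqP; rewrite -addr_eq0 -evX -evq -evM -evD -def_f; exact/eqP.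
  have : red q d %| red q (F ^+ j * s ^+ e).
    apply: rad.
    have -> : ev t (F ^+ j * s ^+ e) / q%:R
      = (-1) ^+ j * q%:R ^+ (e - j.+1) * (ev t (d ^+ j * s) / q%:R) ^+ e.
      rewrite !evM !evX expr_div_n exprMn -exprM mulnC exprM dte.
      rewrite -[- (_ * _)]mulN1r !exprMn.
      have -> : q%:R ^+ e = q%:R ^+ (e - j.+1) * q%:R * q%:R ^+ j :> algC.
        by rewrite -exprSr -exprD -subSn // subSS subnK // ltnW.
      have : (-1) ^+ j * (-1) ^+ j = 1 :> algC by rewrite -expr2 sqrr_sign.
      move: ((-1) ^+ j) => c c1.
      rewrite -[LHS]mul1r -[X in X * _ = _]c1; field.
      by apply/and3P; split=> //; apply: expf_neq0.
    by rewrite rpredM ?rpredX // rpredM ?rpredX ?rpredN ?rpred1 // rpred_nat.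
  rewrite rmorphM !rmorphXn /= Gauss_dvdpr ?coprimep_expr //.
  move/(separable_dvdp_exp sepd)/(red_dvdp q_pr) => [s' [r' def_s]].
  exists s', (d ^+ j * r' + r); rewrite def_h def_s exprSr; ring.
have [s [r ->]] := step e (leqnn e).
exists (r - F * s).
have -> : d ^+ e = f - cst q * F by rewrite def_f addrK.
by rewrite evD evM evB ft !evM evB evM evq; field.
Qed.

(** An element of Q(theta) is h(theta)/N; [dedekind_maximal] cancels one prime factor of N at a
    time. *)
Lemma monogenic_of_dedekind f : f \is monic -> irreducible_poly (pQ f) ->
  (forall q, prime q -> exists d e F, dedekind_at q f d e F) -> monogenic f.
Proof.
move=> f1 f_irr ded; split=> //; split=> // t /rootP ft x [P defx] x_int.
have {P defx} [N N_gt0 [h defx]] :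
    exists2 N, (0 < N)%N & exists h, x = ev t h / N%:R.
  have [h [a a0 defP]] := rat_poly_scale P.
  exists `|a|%N; first by rewrite absz_gt0.
  exists ((sgz a)%:P * h).
  rewrite evM evC defx defP linearZ /= hornerZ fmorphV /= ratr_int.
  have -> : map_poly (ratr : rat -> algC) (pQ h) = map_poly intr h.
    by rewrite -map_poly_comp; apply: eq_map_poly => y; apply: ratr_int.
  have a0C : a%:~R != 0 :> algC by rewrite intr_eq0.
  have -> : `|a|%N%:R = (sgz a * a)%:~R :> algC by rewrite -normrEsg -abszE.
  have s0C : (sgz a)%:~R != 0 :> algC by rewrite intr_eq0 sgz_eq0.
  by rewrite rmorphM /=; field; rewrite a0C s0C.
elim/ltn_ind: N h N_gt0 defx => N IH h N_gt0 defx.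
have [N1|N_neq1] := eqVneq N 1%N; first by exists h; rewrite defx N1 divr1.
have q_pr : prime (pdiv N) by rewrite pdiv_prime // ltn_neqAle eq_sym N_neq1.
set q := pdiv N in q_pr; have /dvdnP[N' defN] := pdiv_dvd N; rewrite -/q in defN.
have N'_gt0 : (0 < N')%N by move: N_gt0; rewrite defN muln_gt0 => /andP[].
have q0 : q%:R != 0 :> algC by rewrite pnatr_eq0 -lt0n prime_gt0.
have N'0 : N'%:R != 0 :> algC by rewrite pnatr_eq0 -lt0n.
have [d [e [F dedF]]] := ded q q_pr.
have [|g Eg] := @dedekind_maximal q f d e F t h q_pr f1 f_irr ft dedF.
  have -> : ev t h / q%:R = x * N'%:R by rewrite defx defN natrM; field; rewrite q0.
  by rewrite rpredM // rpred_nat.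
apply: (IH N' _ g) => //; first by rewrite defN ltn_Pmulr // prime_gt1.
by rewrite -Eg defx defN natrM; field; rewrite ?q0 ?N'0.
Qed.

(** * Irreducibility and non-monogenicity *)

(* A common factor [D] of [A], [B] and [d] modulo [q] makes both [A * B] and
   [d ^+ e] equal to [D ^+ 2 * x + q * D * y] modulo [q ^ 2], so it divides [F]. *)
Lemma dedekind_factor_coprime q f d e F A B : prime q ->
  dedekind_at q f d e F -> (1 < e)%N -> f = A * B ->
  coprimep (red q A) (red q B).
Proof.
move=> q_pr [sepd _ def_f copF] e_gt1 fAB.
have {}copF : coprimep (red q d) (red q F) by move: copF e_gt1; case: eqP => [->|].
have q0 := cst_neq0 q_pr.
have dAB : red q A * red q B = red q d ^+ e.
  rewrite -rmorphM -fAB def_f rmorphD rmorphM /= red_cst // mul0r addr0.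
  by rewrite rmorphXn.
set c := gcdp (red q A) (red q B).
(* A common divisor of A and B modulo q divides d^e, so it is a unit once c is prime to d. *)
have cop_cd : coprimep c (red q d).
  rewrite -gcdp_eqp1; set b := gcdp c (red q d).
  have bd : b %| red q d := dvdp_gcdr _ _.
  have bA : b %| red q A := dvdp_trans (dvdp_gcdl _ _) (dvdp_gcdl _ _).
  have bB : b %| red q B := dvdp_trans (dvdp_gcdl _ _) (dvdp_gcdr _ _).
  apply: (coprimepP _ _ copF) => //.
  have b0 : b != 0.
    by apply: contraTneq bd => ->; rewrite dvd0p separable_poly_neq0.
  have [D defD] := red_surj b q_pr; rewrite -defD in b0 bd bA bB *.
  have [s [A' defA]] := red_dvdp q_pr bA.
  have [t [B' defB]] := red_dvdp q_pr bB.
  have [v [d' defd]] := red_dvdp q_pr bd.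
  pose W := d ^+ (e - 2).
  have deW : d ^+ e = d ^+ 2 * W by rewrite -exprD subnKC.
  have key : D ^+ 2 * (v ^+ 2 * W - s * t)
    = cst q * (D * (s * B' + t * A' - 2 * v * d' * W) - F
               + cst q * (A' * B' - d' ^+ 2 * W)).
    have : A * B = d ^+ 2 * W + cst q * F by rewrite -fAB def_f deW.
    rewrite defA defB defd => E; apply/eqP; rewrite -subr_eq0; apply/eqP.
    transitivity ((D * v + cst q * d') ^+ 2 * W + cst q * F
      - (D * s + cst q * A') * (D * t + cst q * B')); first by ring.
    by rewrite -E subrr.
  have [|X defX] := @red_eq0 q (v ^+ 2 * W - s * t) q_pr.
    have : red q (D ^+ 2) * red q (v ^+ 2 * W - s * t) = 0.
      by rewrite -rmorphM key rmorphM /= red_cst // mul0r.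
    by move/eqP; rewrite mulf_eq0 rmorphXn expf_eq0 /= (negbTE b0) => /eqP.
  move: key; rewrite defX mulrCA => /(mulfI q0) E.
  have -> : F = D * (s * B' + t * A' - 2 * v * d' * W - D * X)
    + cst q * (A' * B' - d' ^+ 2 * W).
    by rewrite mulrBr mulrA -expr2 E; ring.
  by rewrite rmorphD rmorphM rmorphM /= red_cst // mul0r addr0 dvdp_mulr.
apply/coprimepP => r rA rB; have rc : r %| c by rewrite dvdp_gcd rA.
apply: (coprimepP _ _ (coprimep_expr e cop_cd)) => //.
by rewrite -dAB dvdp_mulr.
Qed.

Lemma dedekind_factor_size q f d e F A B : prime q ->
  dedekind_at q f d e F -> (1 < e)%N -> A \is monic -> f = A * B ->
  (e %| (size A).-1)%N.
Proof.
move=> q_pr ded e_gt1 A1 fAB; have cop := dedekind_factor_coprime q_pr ded e_gt1 fAB.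
have [sepd _ def_f _] := ded.
rewrite -(size_red q_pr A1); apply: coprime_factor_exp sepd _ cop.
rewrite -rmorphM -fAB def_f rmorphD rmorphM /= red_cst // mul0r addr0.
by rewrite rmorphXn.
Qed.

(** By Gauss's lemma a rational factor rescales to an integral one. The two leading coefficients
    multiply to 1, so they are a common sign, which can be moved out of both factors. *)
Lemma irreducible_of_monic_factors f : f \is monic -> (1 < size f)%N ->
  (forall A B, A \is monic -> B \is monic -> f = A * B ->
     size A = 1%N \/ size A = size f) ->
  irreducible_poly (pQ f).
Proof.
move=> f1 f_gt1 facts.
have sz (h : {poly int}) : size (pQ h) = size h.
  by rewrite size_map_inj_poly //; apply: intr_inj.
split=> [|P P1 Pf]; first by rewrite sz.
have [A [a a0 defP] [B fAB]] := dvdpP_rat_int Pf.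
have lead : lead_coef A * lead_coef B = 1 by rewrite -lead_coefM -fAB; apply/monicP.
have sA : size P = size A by rewrite defP size_scale // sz.
have uA : lead_coef A * lead_coef A = 1.
  have : lead_coef A \is a GRing.unit by apply/unitrP; exists (lead_coef B); rewrite mulrC.
  by rewrite unfold_in => /orP[]/eqP->.
have lB : lead_coef B = lead_coef A.
  by rewrite -[LHS]mul1r -uA -mulrA lead mulr1.
have cA0 : lead_coef A != 0 by apply: contra_eq_neq uA => ->; rewrite mul0r.
have [] := facts ((lead_coef A)%:P * A) ((lead_coef A)%:P * B).
- by apply/monicP; rewrite lead_coefM lead_coefC.
- by apply/monicP; rewrite lead_coefM lead_coefC lB.
- by rewrite mulrACA -polyCM uA mul1r.
- by rewrite mul_polyC size_scale // -sA => E; rewrite E in P1.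
rewrite mul_polyC size_scale // -sA => E.
by rewrite -dvdp_size_eqp // sz E.
Qed.

Lemma prod_two_values (F : fieldType) (a b : F) ys :
  all [pred y | (y == a) || (y == b)] ys ->
  exists i j, size ys = (i + j)%N /\ \prod_(y <- ys) y = a ^+ i * b ^+ j.
Proof.
elim: ys => [|y ys IH] /=; first by exists 0%N, 0%N; rewrite big_nil mulr1.
case/andP=> Hy /IH[i [j [-> E]]]; rewrite big_cons E.
case/orP: Hy => /eqP->.
  by exists i.+1, j; rewrite addSn exprS mulrA.
by exists i, j.+1; rewrite addnS exprS mulrCA.
Qed.

Lemma size_Fpoly_tail k p : (0 < p)%N ->
  (size (- (cst k * 'X^p) - 1)%R < size ('X^(2 * p) : {poly int})%R)%N.
Proof.
move=> p_gt0; rewrite size_polyXn ltnS.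
apply: leq_trans (size_polyD _ _) _; rewrite geq_max !size_polyN size_poly1.
rewrite muln_gt0 p_gt0 andbT mul_polyC.
apply/andP; split=> //; apply: leq_trans (size_scale_leq _ _) _.
by rewrite size_polyXn mul2n -addnn -[p.+1]addn1 leq_add2l.
Qed.

Lemma Fpoly_monic k p : (0 < p)%N -> Fpoly k p \is monic.
Proof.
move=> p_gt0; rewrite /Fpoly -addrA; apply/monicP.
by rewrite lead_coefDl ?lead_coefXn ?size_Fpoly_tail.
Qed.

Lemma size_Fpoly k p : (0 < p)%N -> size (Fpoly k p) = (2 * p).+1.
Proof.
move=> p_gt0; rewrite /Fpoly -addrA.
by rewrite size_polyDl ?size_Fpoly_tail // size_polyXn.
Qed.

Lemma ev_Fpoly k p t : ev t (Fpoly k p) = (t ^+ p) ^+ 2 - k%:R * t ^+ p - 1.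
Proof.
by rewrite /Fpoly !evB evM !evX evC map_polyX hornerX rmorph1 hornerC mulnC exprM.
Qed.

(* The roots [r] of a factor [A] satisfy [r^p = a] or [r^p = - a^-1] with
   [a > 1]; as [A(0) = +-1], both values occur equally often. *)
Lemma Fpoly_factor_size k p A B : (0 < k)%N -> (0 < p)%N -> A \is monic ->
  Fpoly k p = A * B ->
  exists i, size A = (i + i).+1 /\ (p = 2%N -> ~~ odd i).
Proof.
move=> k_gt0 p_gt0 A1 fAB.
(* [a] is the positive root of x^2 - k x - 1 and - a^-1 the other one; a > 0 and a <> 1 make the
   powers of [a] distinct. *)
pose s : algC := sqrtC (k ^ 2 + 4)%:R; pose a := (k%:R + s) / 2%:R.
have s2 : s ^+ 2 = k%:R ^+ 2 + 4%:R by rewrite sqrtCK natrD natrX.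
have a2 : a ^+ 2 = k%:R * a + 1.
  have two0 : 2%:R != 0 :> algC by rewrite pnatr_eq0.
  by rewrite /a expr_div_n sqrrD s2; field.
have k0 : 0 < k%:R :> algC by rewrite ltr0n.
have a_gt0 : 0 < a.
  by rewrite divr_gt0 ?ltr0n // addr_gt0 // sqrtC_gt0 ltr0n addn_gt0 orbT.
have a_neq1 : a != 1.
  apply: contraTneq k0 => a1; move: a2; rewrite a1 expr1n mulr1.
  by move/eqP; rewrite -subr_eq0 opprD addrCA subrr addr0 oppr_eq0 => /eqP->; rewrite ltxx.
have a0 : a != 0 by rewrite gt_eqF.
have [rs defA] := closed_field_poly_normal (map_poly (intr : int -> algC) A).
rewrite (monicP (monic_map _ A1)) scale1r in defA.
have sA : size A = (size rs).+1.
  by rewrite -(size_prod_XsubC rs id) -defA size_map_inj_poly //; apply: intr_inj.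
have values : all [pred y | (y == a) || (y == - a^-1)] [seq r ^+ p | r <- rs].
  apply/allP => _ /mapP[r r_rs ->] /=.
  have rA : ev r A = 0 by apply/rootP; rewrite defA root_prod_XsubC.
  have : ev r (Fpoly k p) = 0 by rewrite fAB evM rA mul0r.
  rewrite ev_Fpoly -[_ == - _]subr_eq0 -[_ == a]subr_eq0 -mulf_eq0 opprK => E.
  have kE : k%:R = a - a^-1.
    by apply: (mulIf a0); rewrite mulrBl mulVf // -expr2 a2 addrK.
  by rewrite -E kE; apply/eqP; field.
have [i [j [+ prodE]]] := prod_two_values values; rewrite size_map => sz.
pose P := \prod_(r <- rs) r.
have P2 : P ^+ 2 = 1.
  have A0 : ev 0 A = (-1) ^+ size rs * P.
    rewrite defA horner_prod (eq_bigr (fun r => (-1) * r)); last first.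
      by move=> r _; rewrite hornerXsubC sub0r mulN1r.
    by rewrite big_split /= big_const_seq count_predT iter_mulr_1.
  have : A`_0 * B`_0 = -1.
    have := congr1 (fun h : {poly int} => h.[0]) fAB.
    rewrite /= hornerM !horner_coef0 => <-.
    rewrite -horner_coef0 /Fpoly !hornerD !hornerN hornerCM !hornerXn hornerC.
    by rewrite !expr0n muln_eq0 !gtn_eqF //= mulr0 subr0 add0r.
  move=> E; have A02 : A`_0 ^+ 2 = 1.
    have : A`_0 \is a GRing.unit.
      by apply/unitrP; exists (- B`_0); rewrite mulNr mulrN [B`_0 * _]mulrC E opprK.
    by rewrite unfold_in => /orP[]/eqP->.
  have : ev 0 A ^+ 2 = 1 by rewrite horner_coef0 coef_map -rmorphXn A02.
  by rewrite A0 exprMn sqrr_sign mul1r.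
have PpE : P ^+ p = a ^+ i * (- a^-1) ^+ j.
  by rewrite -prodE big_map prodrXl.
(* The product P of the roots of A is +-1 because A(0) B(0) = -1. Squaring P^p removes all signs and
   leaves a^(2i) = a^(2j). *)
have ij : i = j.
  have : (a ^+ i * (- a^-1) ^+ j) ^+ 2 = 1.
    by rewrite -PpE -exprM mulnC exprM P2 expr1n.
  rewrite exprMn -[(_ ^+ j) ^+ 2]exprM mulnC exprM sqrrN -exprM exprVn.
  rewrite exprVn -exprM mulnC => E.
  have : a ^+ (2 * i) = a ^+ (2 * j) by rewrite -[RHS]mul1r -E divfK ?expf_neq0.
  by move/(ieexprIn a_gt0 a_neq1)/eqP; rewrite eqn_mul2l => /eqP.
exists j; rewrite sA sz ij; split=> // p2.
(* For p = 2 the sign survives: 1 = P^2 = (a (- a^-1))^j. *)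
have : (-1) ^+ j = 1 :> algC.
  by move: PpE; rewrite p2 P2 ij -exprMn mulrN divff.
by rewrite -signr_odd; case: (odd j) => // /eqP; rewrite expr1 eqNr oner_eq0.
Qed.

Lemma Aint_of_integralOver x :
  integralOver (intr : int -> algC) x -> x \in Aint.
Proof.
case=> P P1 Px; apply: root_monic_Aint Px _ _; first exact: monic_map.
by apply/polyOverP => i; rewrite coef_map intr_int.
Qed.

Lemma integralOver_of_Aint x :
  x \in Aint -> integralOver (intr : int -> algC) x.
Proof. by case/Aint_int_root=> P P1 P0; exists P; last apply/rootP. Qed.

Lemma Aint_root_quadratic (b c z : algC) :
  b \in Aint -> c \in Aint -> z ^+ 2 + b * z + c = 0 -> z \in Aint.
Proof.
move=> b_int c_int zE; apply: Aint_of_integralOver.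
apply: (@integral_root_monic _ _ _ _ ('X^2 + (b%:P * 'X + c%:P))).
- apply/monicP; rewrite lead_coefDl ?lead_coefXn // size_polyXn size_MXaddC.
  by case: ifP => // _; rewrite !ltnS size_polyC leq_b1.
- by apply/rootP; rewrite !hornerD hornerXn hornerCM hornerX hornerC addrA.
apply: (proj1 (integral_poly _ _)) => i; rewrite !coefD coefXn coefCM coefX coefC.
apply: integral_add; first exact: integral_nat.
apply: integral_add.
  by apply: integral_mul; [apply: integralOver_of_Aint | apply: integral_nat].
by case: ifP => _; [apply: integralOver_of_Aint | apply: integral0].
Qed.

(* With [y = g(theta)], the element [z = y^(e+1) / q] satisfies
   [z^2 + G z + y^e H = 0]. *)
Lemma not_monogenic q f g e G H : prime q -> g \is monic -> (1 < size g)%N ->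
  f = g ^+ e.+2 + cst q * (g * G + cst q * H) -> ~ monogenic f.
Proof.
move=> q_pr g1 g_gt1 def_f [f1 [f_irr mono]].
have sf : size (map_poly (intr : int -> algC) f) != 1%N.
  case: f_irr => + _; rewrite !size_map_inj_poly //; try exact: intr_inj.
  by apply: contraTneq => ->.
have [t ft] := closed_rootP _ sf.
have f0 : ev t f = 0 by apply/rootP.
have q0 : q%:R != 0 :> algC by rewrite pnatr_eq0 -lt0n prime_gt0.
have evq : ev t (cst q) = q%:R by rewrite evC.
pose z := ev t (g ^+ e.+1) / q%:R.
have zE : z ^+ 2 + ev t G * z + ev t (g ^+ e * H) = 0.
  have : ev t g ^+ e.+2 = - (q%:R * (ev t g * ev t G + q%:R * ev t H)).
    apply/eqP; rewrite -addr_eq0 -evX -evq -!evM -evD -evM -evD -def_f.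
    exact/eqP.
  rewrite /z evM !evX !exprS; move: (ev t g) (ev t g ^+ e) => y w E.
  have E' : y * (y * w) * w = - (q%:R * (y * ev t G + q%:R * ev t H)) * w by rewrite E.
  transitivity ((y * (y * w) * w + q%:R * (y * ev t G + q%:R * ev t H) * w) / q%:R ^+ 2).
    by field.
  by rewrite E'; field.
have z_int : z \in Aint.
  by apply: Aint_root_quadratic zE; apply: (Aint_ev _ f1 f0).
have [|s zs] := mono t ft z _ z_int.
  exists (q%:R^-1 *: pQ (g ^+ e.+1)).
  rewrite linearZ /= hornerZ fmorphV /= ratr_nat /z mulrC; congr (_ * _.[t]).
  by rewrite -map_poly_comp; apply: eq_map_poly => y; rewrite /= ratr_int.
(* If z were s(theta), then f would divide g^(e+1) - q s, and g^(e+2) would divide g^(e+1) modulo q,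
   which its degree forbids. *)
have [|w Ew] := @irr_ev_eq0 f t (g ^+ e.+1 - cst q * s) f1 f_irr f0.
  by rewrite evB evM evq -zs /z mulrC divfK // subrr.
have : red q g ^+ e.+2 %| red q g ^+ e.+1.
  have -> : red q g ^+ e.+1 = red q f * red q w.
    by rewrite -rmorphM -Ew rmorphB rmorphM /= red_cst // mul0r subr0 rmorphXn.
  rewrite def_f rmorphD rmorphXn rmorphM /= red_cst // mul0r addr0.
  exact: dvdp_mulr.
by rewrite dvdp_Pexp2l ?size_red // ltnn.
Qed.

(** * The trinomials F_p *)

Lemma coprimep_const (F : fieldType) (p : {poly F}) c :
  c != 0 -> coprimep p c%:P.
Proof.
move=> c0; apply/Bezout_eq1_coprimepP; exists (0, c^-1%:P).
by rewrite /= mul0r add0r -polyCM mulVf.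
Qed.

Lemma coprimep_opp (F : fieldType) (p q : {poly F}) :
  coprimep p (- q) = coprimep p q.
Proof. by rewrite -scaleN1r coprimepZr // oppr_eq0 oner_eq0. Qed.

Lemma separable_trinomial (F : fieldType) (c : F) n :
  n.+1%:R != 0 :> F -> c ^+ 2 + 4 != 0 ->
  separable_poly ('X^(2 * n.+1) - c%:P * 'X^(n.+1) - 1).
Proof.
move=> n0 c0; set f := _ - 1.
have fE : f = 'X^(n.+1) * 'X^(n.+1) - c%:P * 'X^(n.+1) - 1.
  by rewrite /f mul2n -addnn exprD.
have f'E : f^`() = n.+1%:R%:P * ('X^n * (2%:R * 'X^(n.+1) - c%:P)).
  rewrite fE !derivB !derivM derivC derivXn /= derivC polyC_natr -mulr_natl.
  by ring.
rewrite separable_poly.unlock f'E coprimepMr; apply/andP; split.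
  exact: coprimep_const.
rewrite coprimepMr; apply/andP; split.
  apply: coprimep_expr; rewrite coprimepX /root fE !hornerE.
  by rewrite !expr0n /= !mulr0 subr0 add0r oppr_eq0 oner_eq0.
apply/Bezout_eq1_coprimepP.
(* With y = X^(n+1), this is (2y - c)^2 - 4 (y^2 - c y - 1) = c^2 + 4, divided by the right side. *)
exists (- ((c ^+ 2 + 4)^-1%:P * 4%:R), (c ^+ 2 + 4)^-1%:P * (2%:R * 'X^(n.+1) - c%:P)).
rewrite /= fE.
transitivity ((c ^+ 2 + 4)^-1%:P * (c%:P ^+ 2 + 4%:R)); first by ring.
by rewrite -polyC_natr -rmorphXn -rmorphD -rmorphM /= mulVf.
Qed.

Lemma separable_Xn_sub (F : fieldType) (c : F) n :
  n.+1%:R != 0 :> F -> c != 0 -> separable_poly ('X^(n.+1) - c%:P).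
Proof.
move=> n0 c0; rewrite separable_poly.unlock derivB derivC subr0 derivXn /=.
rewrite -mulr_natl -polyC_natr coprimepMr; apply/andP; split.
  exact: coprimep_const.
apply: coprimep_expr; rewrite coprimepX /root !hornerE expr0n /= sub0r.
by rewrite oppr_eq0.
Qed.

Lemma red_Fpoly q k p :
  red q (Fpoly k p) = 'X^(2 * p) - (k%:Z%:~R)%:P * 'X^p - 1.
Proof.
rewrite /Fpoly !rmorphB rmorphM /= !map_polyXn map_polyC rmorph1 //.
Qed.

Lemma red_Fpoly_separable q k n : prime q -> ~~ (q %| n.+1)%N ->
  ~~ (q %| k ^ 2 + 4)%N -> separable_poly (red q (Fpoly k n.+1)).
Proof.
move=> q_pr qn qD; rewrite red_Fpoly; apply: separable_trinomial.
  by rewrite -(dvdn_pcharf (pchar_Fp q_pr)).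
have -> : (k%:Z%:~R : 'F_q) ^+ 2 + 4 = (k ^ 2 + 4)%:R by rewrite natrD natrX.
by rewrite -(dvdn_pcharf (pchar_Fp q_pr)).
Qed.

Lemma dedekind_other q k n : prime q -> ~~ (q %| n.+1)%N ->
  ~~ (q %| k ^ 2 + 4)%N -> dedekind_at q (Fpoly k n.+1) (Fpoly k n.+1) 1 0.
Proof.
move=> q_pr qn qD; split=> //; first exact: red_Fpoly_separable.
by rewrite mulr0 addr0.
Qed.

(** gcd(2, k)^2 is 1 or 4, hence prime to the odd q. *)
Lemma squarefree_disc q k : prime q -> odd q ->
  squarefree ((k ^ 2 + 4) %/ (gcdn 2 k) ^ 2) -> ~~ (q ^ 2 %| k ^ 2 + 4)%N.
Proof.
move=> q_pr q_odd /(_ q q_pr); apply: contra => dvd.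
have [k_odd|k_even] := boolP (odd k).
  have -> : gcdn 2 k = 1%N by apply/eqP; rewrite -/(coprime 2 k) coprime2n.
  by rewrite exp1n divn1.
have dv2 : (2 %| k)%N by rewrite dvdn2.
have -> : gcdn 2 k = 2%N by apply/gcdn_idPl.
have d4 : (2 ^ 2 %| k ^ 2 + 4)%N by rewrite dvdn_addl // dvdn_exp2r.
move: dvd; rewrite -{1}(divnK d4) Gauss_dvdl //.
by rewrite coprime_sym coprimeXl // coprimeXr // coprime2n.
Qed.

(** c is a lift of k/2, the double root of x^2 - k x - 1 modulo q. For q = 2, k = 2 modulo 4 and c =
    1 works; for odd q, the inverse of 2 modulo q^2 is m = (q^2 + 1)/2, and 4 (c^2 + 1) = k^2 + 4
    modulo q^2. *)
Lemma exists_root_mod_disc q k : prime q -> (q %| k ^ 2 + 4)%N ->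
  ~~ (4 %| k)%N -> squarefree ((k ^ 2 + 4) %/ (gcdn 2 k) ^ 2) ->
  exists c : int, [/\ ((q ^ 2)%:Z %| 2 * c - k%:Z)%Z, (q%:Z %| c ^+ 2 + 1)%Z
    & ~~ ((q ^ 2)%:Z %| c ^+ 2 + 1)%Z].
Proof.
move=> q_pr qD k4 sqf; have [q2|q_odd] := even_prime q_pr.
  exists 1; rewrite q2 in qD *; split=> //.
  have k_even : ~~ odd k by move: qD; rewrite dvdn2 oddD oddX /=; case: odd.
  have [m km] : exists m, k = (m.*2.+1).*2.
    by exists (k %/ 4)%N; lia.
  by apply/dvdzP; exists (- m%:Z); rewrite km Posz_sqr; lia.
have q2 := odd_prime_dvdz2 q_pr q_odd.
have [m qm] : exists m, (q ^ 2 + 1 = 2 * m)%N.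
  exists ((q ^ 2 + 1) %/ 2)%N; rewrite mulnC divnK // dvdn2 oddD oddX.
  by rewrite q_odd.
have qmz : q%:Z ^+ 2 + 1 = 2 * m%:Z by rewrite -Posz_sqr -PoszD qm PoszM.
exists (k%:Z * m%:Z).
have cE : 2 * (2 * ((k%:Z * m%:Z) ^+ 2 + 1))
  = (k ^ 2 + 4)%:Z + (q ^ 2)%:Z * (k%:Z ^+ 2 * (q%:Z ^+ 2 + 2)).
  rewrite PoszD !Posz_sqr.
  transitivity (k%:Z ^+ 2 * (2 * m%:Z) ^+ 2 + 4%:Z); first by ring.
  by rewrite -qmz; ring.
have qq : (q%:Z %| (q ^ 2)%:Z)%Z by rewrite dvdzE /= dvdn_exp.
split.
- have -> : 2 * (k%:Z * m%:Z) - k%:Z = k%:Z * (q ^ 2)%:Z.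
    by rewrite mulrCA -qmz Posz_sqr; ring.
  exact: dvdz_mull.
- have : (q%:Z %| 2 * (2 * ((k%:Z * m%:Z) ^+ 2 + 1)))%Z.
    by rewrite cE rpredD // dvdz_mulr.
  by rewrite !Euclid_dvdzM // (negbTE q2).
apply: contra (squarefree_disc q_pr q_odd sqf) => dvd.
have : ((q ^ 2)%:Z %| (k ^ 2 + 4)%:Z)%Z.
  rewrite -(rpredDr _ (dvdz_mulr (k%:Z ^+ 2 * (q%:Z ^+ 2 + 2)) (dvdzz (q ^ 2)%:Z))).
  by rewrite -cE !dvdz_mull.
by [].
Qed.

Lemma red_eq q (a b : int) : prime q -> (q%:Z %| a - b)%Z ->
  a%:~R = b%:~R :> 'F_q.
Proof.
by move=> q_pr; rewrite -intrFp_eq0 // rmorphB subr_eq0 => /eqP.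
Qed.

(** Complete the square: with 2c - k = m q^2 and c^2 + 1 = r q, f = (x^p - c)^2 + q (q m x^p - r).
    Modulo q the cofactor is the constant -r, nonzero because q^2 does not divide c^2 + 1. *)
Lemma dedekind_disc q k n (c : int) : prime q -> ~~ (q %| n.+1)%N ->
  ((q ^ 2)%:Z %| 2 * c - k%:Z)%Z -> (q%:Z %| c ^+ 2 + 1)%Z ->
  ~~ ((q ^ 2)%:Z %| c ^+ 2 + 1)%Z ->
  exists d F, dedekind_at q (Fpoly k n.+1) d 2 F.
Proof.
move=> q_pr qn /dvdzP[m Hm] /dvdzP[r Hr] nq2.
exists ('X^(n.+1) - c%:P), (cst q * m%:P * 'X^(n.+1) - r%:P).
have qc : ~~ (q%:Z %| c)%Z.
  apply/negP => qc; have : (q%:Z %| 1)%Z.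
    have -> : 1%Z = (c ^+ 2 + 1) - c * c by ring.
    by rewrite rpredB ?dvdz_mulr // Hr dvdz_mull.
  by rewrite dvdzE /= dvdn1 => /eqP q1; rewrite q1 in q_pr.
have redd : red q ('X^(n.+1) - c%:P) = 'X^(n.+1) - (c%:~R)%:P.
  by rewrite rmorphB /= map_polyXn map_polyC.
split=> //.
- rewrite redd; apply: separable_Xn_sub; last by rewrite intrFp_eq0.
  by rewrite -(dvdn_pcharf (pchar_Fp q_pr)).
- rewrite /Fpoly mul2n -addnn exprD.
  have -> : k%:Z = 2 * c - m * (q ^ 2)%:Z by rewrite -Hm; ring.
  have -> : (1 : {poly int}) = (r * q%:Z - c ^+ 2)%:P by rewrite -Hr; congr polyC; ring.
  by rewrite Posz_sqr; ring.
apply/orP; right; rewrite !rmorphB !rmorphM /= red_cst // !mul0r sub0r.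
rewrite coprimep_opp [map_poly _ r%:P]map_polyC; apply: coprimep_const; rewrite intrFp_eq0 //.
apply: contra nq2 => /dvdzP[r' Er]; rewrite Hr Er Posz_sqr; apply/dvdzP.
by exists r'; ring.
Qed.

(** * Dedekind data at the prime p itself *)

Lemma exp_Fp p (x : 'F_p) : prime p -> x ^+ p = x.
Proof. by move=> p_pr; rewrite -[X in x ^+ X](card_Fp p_pr) expf_card. Qed.

Lemma coprimep_red_addMl q (g a b : {poly int}) :
  coprimep (red q g) (red q (g * a + b)) = coprimep (red q g) (red q b).
Proof. by rewrite rmorphD rmorphM mulrC coprimep_addl_mul. Qed.

Lemma dvdp_red_addMl q (g a b : {poly int}) : prime q ->
  (red q g %| red q (g * a + b)) = (red q g %| red q b).
Proof. by move=> q_pr; rewrite rmorphD rmorphM /= dvdp_addr // dvdp_mulr. Qed.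

Lemma red_congr q (g a c : {poly int}) n : prime q ->
  red q (g * a + g ^+ n + cst q * c) = red q g * red q a + red q g ^+ n.
Proof.
by move=> q_pr; rewrite !rmorphD !rmorphM rmorphXn /= red_cst // mul0r addr0.
Qed.

Lemma red_Fpoly_pow k p : prime p -> red p (Fpoly k p) = red p (Fpoly k 1) ^+ p.
Proof.
move=> p_pr; rewrite !red_Fpoly muln1.
have chp : p \in [pchar {poly 'F_p}] by rewrite pchar_poly pchar_Fp.
rewrite -[RHS](pFrobenius_autE chp) !rmorphB rmorphM rmorph1 /= !pFrobenius_autE.
by rewrite exprMn expr1 -polyC_exp exp_Fp // mul2n -addnn exprD.
Qed.

Lemma fermatz p (c : int) : prime p -> (p%:Z %| c ^+ p - c)%Z.
Proof.
by move=> p_pr; rewrite -intrFp_eq0 // rmorphB rmorphXn /= exp_Fp // subrr.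
Qed.

(** F is prime to x - c modulo p when p does not divide F(c). Now p F(c) = f(c), and c^p = c modulo
    p with 2c = k modulo p^2 gives f(c) = -(c^2 + 1) modulo p^2. *)
Lemma dedekind_ramified p k (c : int) : prime p ->
  ((p ^ 2)%:Z %| 2 * c - k%:Z)%Z -> (p%:Z %| c ^+ 2 + 1)%Z ->
  ~~ ((p ^ 2)%:Z %| c ^+ 2 + 1)%Z ->
  exists d F, dedekind_at p (Fpoly k p) d (2 * p) F.
Proof.
move=> p_pr ck c1 nc1; exists ('X - c%:P).
have redd : red p ('X - c%:P) = 'X - (c%:~R)%:P.
  by rewrite rmorphB /= map_polyX map_polyC.
have [|F EF] := @red_eq0 p (Fpoly k p - ('X - c%:P) ^+ (2 * p)) p_pr.
  rewrite rmorphB rmorphXn /= redd red_Fpoly_pow // exprM.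
  have -> : red p (Fpoly k 1) = ('X - (c%:~R)%:P) ^+ 2; last by rewrite subrr.
  rewrite red_Fpoly muln1 expr1.
  have -> : k%:Z%:~R = (2 * c)%:~R :> 'F_p.
    by apply/esym/red_eq => //; apply: dvdz_sqr.
  have -> : (1 : {poly 'F_p}) = (- c ^+ 2)%:~R%:P.
    rewrite -[1]/(1%:P); congr polyC; rewrite -[1]/(1%:~R).
    by apply: red_eq => //; rewrite opprK addrC.
  by ring.
exists F; split.
- by rewrite redd separable_poly.unlock derivB derivX derivC subr0 coprimep1.
- by rewrite muln_gt0 /= prime_gt0.
- by rewrite -EF addrC subrK.
apply/orP; right; rewrite redd coprimep_sym coprimep_XsubC /root.
rewrite horner_map intrFp_eq0 //; apply: contra nc1 => /dvdzP[x Fx].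
have := congr1 (fun h : {poly int} => h.[c]) EF.
have d0 : (('X - c%:P) ^+ (2 * p)).[c] = 0.
  by rewrite horner_exp hornerXsubC subrr expr0n muln_eq0 !gtn_eqF ?prime_gt0.
rewrite /= hornerM hornerC Fx hornerD hornerN d0 subr0 /Fpoly !hornerD !hornerN.
rewrite hornerCM !hornerXn hornerC mulnC exprM.
have /dvdzP[y Ey] := fermatz c p_pr.
have {Ey} -> : c ^+ p = c + y * p by rewrite -Ey; ring.
have /dvdzP[m Hm] := ck => E.
have -> : c ^+ 2 + 1 = (p%:Z * y) ^+ 2 + (2 * c - k%:Z) * (c + y * p) - p%:Z * (x * p%:Z).
  by rewrite -E; ring.
rewrite Hm Posz_sqr; apply/dvdzP.
by exists (y ^+ 2 + m * (c + y * p) - x); ring.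
Qed.

(** This is alpha^(n+1) = U_(n+1) alpha + U_n, read in Z[x] modulo g. *)
Lemma Xn_mod_Fpoly1 k n : exists Q,
  'X^(n.+1) = Fpoly k 1 * Q + (u k n.+1)%:P * 'X + (u k n)%:P.
Proof.
elim: n => [|n [Q EQ]]; first by exists 0; rewrite U0 U1; ring.
exists (Q * 'X + (u k n.+1)%:P).
by rewrite exprSr EQ U_rec PoszD PoszM /Fpoly; ring.
Qed.

(** For odd p, alpha^p is a root of y^2 - V_p y - 1, so f(alpha) = (V_p - k) alpha^p. *)
Lemma Fpoly_trace k n : odd n.+1 -> exists T,
  Fpoly k n.+1
  = Fpoly k 1 * T + (k%:Z * u k n.+1 + 2 * u k n - k%:Z)%:P * 'X^(n.+1).
Proof.
move=> n_even; have [Q EQ] := Xn_mod_Fpoly1 k n.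
have cas := cassini k n; rewrite -signr_odd (negbTE (_ : ~~ odd n)) // expr0 in cas.
pose L : {poly int} := (u k n.+1)%:P * 'X + (u k n)%:P.
exists (Fpoly k 1 * Q ^+ 2 + 2%:R * Q * L - (k%:Z * u k n.+1 + 2 * u k n)%:P * Q
  + (u k n.+1)%:P ^+ 2).
(* Replacing the constant 1 by its Cassini form makes the claim a polynomial identity in U_p and
   U_(p-1). *)
have -> : Fpoly k n.+1 = ('X^(n.+1)) ^+ 2 - (k%:Z)%:P * 'X^(n.+1)
   - (u k n.+1 ^+ 2 - k%:Z * u k n.+1 * u k n - u k n ^+ 2)%:P.
  by rewrite cas /Fpoly mulnC exprM.
by rewrite EQ /L /Fpoly; ring.
Qed.

Lemma coprimep_red_Fpoly1_Xn q k n : prime q ->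
  coprimep (red q (Fpoly k 1)) 'X^n.
Proof.
move=> q_pr; apply: coprimep_expr; rewrite coprimepX /root red_Fpoly !hornerE.
by rewrite expr0n /= subr0 add0r oppr_eq0 oner_eq0.
Qed.

(** Compare [Fpoly_trace] with f = g^p modulo p: g divides t x^p and is prime to x, so p divides t
    by degree; cancelling g then shows that the cofactor is g^(p-1) modulo p. *)
Lemma Fpoly_trace_mod k n : prime n.+1 -> odd n.+1 -> exists T w,
  k%:Z * u k n.+1 + 2 * u k n - k%:Z = w * n.+1%:Z /\
  Fpoly k n.+1 = Fpoly k 1 ^+ n.+1
    + cst n.+1 * (Fpoly k 1 * T + w%:P * 'X^(n.+1)).
Proof.
set p := n.+1 => p_pr p_odd; have [T0 E0] := Fpoly_trace k p_odd.
rewrite -/p in E0; set t := _ - _ in E0 *.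
have g1 : Fpoly k 1 \is monic by apply: Fpoly_monic.
have sg : size (red p (Fpoly k 1)) = 3%N by rewrite size_red ?size_Fpoly.
have pt : (p%:Z %| t)%Z.
  have : red p (Fpoly k 1) %| red p (Fpoly k p).
    by rewrite red_Fpoly_pow // dvdp_exp // prime_gt0.
  rewrite E0 dvdp_red_addMl // rmorphM /= map_polyC map_polyXn.
  rewrite Gauss_dvdpl ?coprimep_red_Fpoly1_Xn // -intrFp_eq0 // => dvd.
  apply: contraTT dvd => t0; apply/negP => /dvdp_leq.
  by rewrite polyC_eq0 => /(_ t0); rewrite sg size_polyC t0.
have /dvdzP[w Hw] := pt.
have [|T ET] := @red_eq0 p (T0 - Fpoly k 1 ^+ n) p_pr.
  have : red p (Fpoly k 1) * red p (T0 - Fpoly k 1 ^+ n) = 0.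
    have := red_congr (Fpoly k 1) (T0 - Fpoly k 1 ^+ n) (w%:P * 'X^p) p p_pr.
    have -> : Fpoly k 1 * (T0 - Fpoly k 1 ^+ n) + Fpoly k 1 ^+ p
      + cst p * (w%:P * 'X^p) = Fpoly k p by rewrite E0 Hw exprS; ring.
    by rewrite red_Fpoly_pow // -[LHS]add0r => /addIr.
  move/eqP; rewrite mulf_eq0 => /orP[/eqP g0|/eqP //].
  by rewrite g0 size_poly0 in sg.
exists T, w; split=> //.
by rewrite E0 Hw -[T0](subrK (Fpoly k 1 ^+ n)) ET [Fpoly k 1 ^+ p]exprS; ring.
Qed.

Lemma dedekind_unramified_odd k n T w : prime n.+1 ->
  ~~ (n.+1 %| k ^ 2 + 4)%N -> ~~ (n.+1%:Z %| w)%Z ->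
  Fpoly k n.+1 = Fpoly k 1 ^+ n.+1
    + cst n.+1 * (Fpoly k 1 * T + w%:P * 'X^(n.+1)) ->
  dedekind_at n.+1 (Fpoly k n.+1) (Fpoly k 1) n.+1
    (Fpoly k 1 * T + w%:P * 'X^(n.+1)).
Proof.
move=> p_pr pD pw fE; split=> //.
  by apply: red_Fpoly_separable => //; rewrite dvdn1; apply: contraTneq p_pr => ->.
apply/orP; right; rewrite coprimep_red_addMl rmorphM /= map_polyC map_polyXn.
rewrite coprimepMr coprimep_red_Fpoly1_Xn // andbT.
by apply: coprimep_const; rewrite intrFp_eq0.
Qed.

Lemma dedekind_unramified_2 k : odd k -> exists F,
  dedekind_at 2 (Fpoly k 2) (Fpoly k 1) 2 F.
Proof.
move=> k_odd; have [m km] : exists m, k = m.*2.+1 by exists k./2; lia.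
(* c = (k^2 - k + 2)/2 is the coefficient of x^2 in (f - g^2)/2 - k x g. *)
pose c : int := 2 * m%:Z ^+ 2 + m%:Z + 1.
exists ((k%:Z)%:P * 'X * Fpoly k 1 + c%:P * 'X^2 - 1).
have pr2 : prime 2 by [].
split=> //.
- by apply: red_Fpoly_separable => //; rewrite dvdn2 oddD oddX k_odd.
- have kz : k%:Z = 2 * m%:Z + 1 by rewrite km; lia.
  by rewrite /c /Fpoly kz; ring.
apply/orP; right; rewrite [_ * Fpoly k 1]mulrC -addrA coprimep_red_addMl.
have -> : red 2 (c%:P * 'X^2 - 1) = (c%:~R)%:P * 'X^2 - 1.
  by rewrite rmorphB rmorphM /= map_polyC map_polyXn rmorph1.
(* Modulo 2 and g, the remainder c x^2 - 1 is the unit -1 when m is odd, and x when m is even, since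
   then x^2 - 1 = g + x. *)
have [m_odd|m_even] := boolP (odd m).
  rewrite (_ : c%:~R = 0) ?mul0r ?sub0r ?coprimep_opp ?coprimep1 //.
  apply/eqP; rewrite intrFp_eq0 //; apply/dvdzP.
  have [j jm] : exists j, m = j.*2.+1 by exists m./2; lia.
  by exists (m%:Z ^+ 2 + j%:Z + 1); rewrite /c jm; nia.
have -> : c%:~R = 1 :> 'F_2.
  apply: (@red_eq 2 c 1) => //; apply/dvdzP.
  have [j jm] : exists j, m = j.*2 by exists m./2; lia.
  by exists (m%:Z ^+ 2 + j%:Z); rewrite /c jm; nia.
have k1 : k%:Z%:~R = 1 :> 'F_2.
  by apply: (@red_eq 2 k 1) => //; rewrite km; apply/dvdzP; exists m%:Z; lia.
have -> : 1%:P * 'X^2 - 1 = 1 * red 2 (Fpoly k 1) + 'X.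
  by rewrite red_Fpoly k1; ring.
by rewrite coprimep_addl_mul -['X]expr1 coprimep_red_Fpoly1_Xn.
Qed.

(** * Irreducibility and monogenicity of F_p *)

Lemma size_monic_factor (A B : {poly int}) : A \is monic -> B \is monic ->
  (size A <= size (A * B)%R)%N.
Proof.
move=> A1 B1; rewrite size_Mmonic ?monic_neq0 // -subn1 -addnBA ?leq_addr //.
by rewrite size_poly_gt0 monic_neq0.
Qed.

Lemma dvdn_leq_cases m s : (m %| s)%N -> (s <= m)%N -> s = 0%N \/ s = m.
Proof.
move=> ms le; have [->|s_gt0] := posnP s; [by left | right].
by apply/eqP; rewrite eqn_leq le dvdn_leq.
Qed.

Lemma Fpoly_irreducible_ramified p k d F : prime p ->
  dedekind_at p (Fpoly k p) d (2 * p) F -> irreducible_poly (pQ (Fpoly k p)).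
Proof.
move=> p_pr ded; have p_gt0 := prime_gt0 p_pr.
apply: irreducible_of_monic_factors; first exact: Fpoly_monic.
  by rewrite size_Fpoly // ltnS muln_gt0.
move=> A B A1 B1 fAB; have le := size_monic_factor A1 B1.
have e_gt1 : (1 < 2 * p)%N by rewrite -[1%N]muln1 ltn_mul // prime_gt1.
have := dedekind_factor_size p_pr ded e_gt1 A1 fAB.
case sA: (size A) le => [|m] le.
  by move/eqP: sA; rewrite size_poly_eq0 (negbTE (monic_neq0 A1)).
rewrite -fAB size_Fpoly // ltnS /= in le *.
by case/dvdn_leq_cases/(_ le) => ->; [left | right].
Qed.

(** A monic factor has degree 2i with p dividing 2i. For odd p this gives p | i; for p = 2 the
    parity of i comes from [Fpoly_factor_size]. So i is 0 or p. *)
Lemma Fpoly_irreducible_unramified p k d F : prime p -> (0 < k)%N ->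
  dedekind_at p (Fpoly k p) d p F -> irreducible_poly (pQ (Fpoly k p)).
Proof.
move=> p_pr k_gt0 ded; have p_gt0 := prime_gt0 p_pr.
apply: irreducible_of_monic_factors; first exact: Fpoly_monic.
  by rewrite size_Fpoly // ltnS muln_gt0.
move=> A B A1 B1 fAB; have le := size_monic_factor A1 B1.
have := dedekind_factor_size p_pr ded (prime_gt1 p_pr) A1 fAB.
have [i [sA i_even]] := Fpoly_factor_size k_gt0 p_gt0 A1 fAB.
rewrite -fAB size_Fpoly // sA ltnS addnn -mul2n leq_pmul2l // in le *.
move=> /= pi; have pi' : (p %| i)%N.
  have [p2|p_odd] := even_prime p_pr; first by rewrite p2 dvdn2 i_even.
  by move: pi; rewrite Gauss_dvdr // coprime_sym coprime2n.
by case: (dvdn_leq_cases pi' le) => ->; [left | right].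
Qed.

(** At q <> p the data always exist: completing the square if q | k^2 + 4, separability
    otherwise. *)
Lemma Fpoly_monogenic k p d e F : prime p -> ~~ (4 %| k)%N ->
  squarefree ((k ^ 2 + 4) %/ (gcdn 2 k) ^ 2) ->
  irreducible_poly (pQ (Fpoly k p)) -> dedekind_at p (Fpoly k p) d e F ->
  monogenic (Fpoly k p).
Proof.
move=> p_pr k4 sqf irr ded; apply: monogenic_of_dedekind => //.
  by apply: Fpoly_monic; apply: prime_gt0.
move=> q q_pr; have [->|q_neq] := eqVneq q p; first by exists d, e, F.
have qp : ~~ (q %| p)%N by rewrite dvdn_prime2.
case: p p_pr qp {irr ded q_neq} => // n p_pr qp.
have [qD|qD] := boolP (q %| k ^ 2 + 4)%N; last first.
  by exists (Fpoly k n.+1), 1%N, 0; apply: dedekind_other.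
have [c [c1 c2 c3]] := exists_root_mod_disc q_pr qD k4 sqf.
by have [d' [F' ?]] := dedekind_disc q_pr qp c1 c2 c3; exists d', 2%N, F'.
Qed.

Lemma Fpoly_monogenic_ramified k p : prime p -> ~~ (4 %| k)%N ->
  squarefree ((k ^ 2 + 4) %/ (gcdn 2 k) ^ 2) -> (p %| k ^ 2 + 4)%N ->
  monogenic (Fpoly k p).
Proof.
move=> p_pr k4 sqf pD; have [c [c1 c2 c3]] := exists_root_mod_disc p_pr pD k4 sqf.
have [d [F ded]] := dedekind_ramified p_pr c1 c2 c3.
apply: Fpoly_monogenic (ded) => //; exact: Fpoly_irreducible_ramified ded.
Qed.

(** Both sides are equivalent to p | w, where p w = V_p - k. *)
Lemma wall_sun_sun_unramified k n : prime n.+1 -> odd n.+1 -> (0 < k)%N ->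
  ~~ (4 %| k)%N -> squarefree ((k ^ 2 + 4) %/ (gcdn 2 k) ^ 2) ->
  ~~ (n.+1 %| k ^ 2 + 4)%N ->
  wall_sun_sun k n.+1 <-> ~ monogenic (Fpoly k n.+1).
Proof.
move=> p_pr p_odd k_gt0 k4 sqf pD.
have [T [w [tw fE]]] := Fpoly_trace_mod k p_pr p_odd.
have pt : (n.+1%:Z %| k%:Z * u k n.+1 + 2 * u k n - k%:Z)%Z.
  by rewrite tw dvdz_mull.
rewrite (wall_sun_sun_trace p_pr p_odd pD pt) tw.
have -> : ((n.+1 ^ 2)%:Z %| w * n.+1%:Z)%Z = (n.+1%:Z %| w)%Z.
  by rewrite Posz_sqr expr2 dvdz_mul2r.
split=> [pw|mono].
  have /dvdzP[w' Hw] := pw; rewrite {}Hw in fE.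
  case: n p_pr {p_odd pD tw pt pw} fE => // e p_pr fE.
  (* With w = p w', f has the shape g^p + p (g T + p H) for H = w' x^p, where p = e + 2. *)
  apply: (@not_monogenic e.+2 _ (Fpoly k 1) e T (w'%:P * 'X^(e.+2))) => //.
  - exact: Fpoly_monic.
  - by rewrite size_Fpoly.
  by rewrite fE polyCM; ring.
apply/negPn/negP => pw; apply: mono.
have ded := dedekind_unramified_odd p_pr pD pw fE.
apply: Fpoly_monogenic (ded) => //; exact: Fpoly_irreducible_unramified ded.
Qed.

Local Close Scope ring_scope.

Theorem theorem1p1 (p k : nat) :
  prime p -> 1 <= k -> ~~ (4 %| k) ->
  squarefree ((k ^ 2 + 4) %/ (gcdn 2 k) ^ 2) ->
  (wall_sun_sun k p <-> ~ monogenic (Fpoly k p)) /\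
  (p %| k ^ 2 + 4 -> monogenic (Fpoly k p)).
Proof.
move=> p_pr k_gt0 k4 sqf; have ram := Fpoly_monogenic_ramified p_pr k4 sqf.
split=> //; have [p2|p_odd] := even_prime p_pr.
  (* For p = 2 both sides of the equivalence are false, whether or not 2 divides k^2 + 4. *)
  have mono : monogenic (Fpoly k p).
    have [/ram //|pD] := boolP (p %| k ^ 2 + 4)%N.
    have k_odd : odd k by move: pD; rewrite p2 dvdn2 oddD oddX /= addbF negbK.
    have [F ded] := dedekind_unramified_2 k_odd; rewrite -p2 in ded.
    apply: Fpoly_monogenic (ded) => //; exact: Fpoly_irreducible_unramified ded.
  by split=> // wss; case: (@not_wall_sun_sun_2 k k4); rewrite -p2.
(* For an odd p dividing k^2 + 4 both sides are false again. *)
have [pD|pD] := boolP (p %| k ^ 2 + 4)%N.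
  split=> [/(not_wall_sun_sun_ramified p_pr p_odd pD) //|].
  by case; apply: ram.
case: p p_pr p_odd pD {ram} => // n p_pr p_odd pD.
exact: wall_sun_sun_unramified.
Qed.
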